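(* Let $n,m\ge0$ be integers. For $g\in\tilde{\mathfrak S}_n$ and $h\in\tilde{\mathfrak S}_m$ one has, in $\tilde{\mathfrak S}_{n+m}$, $$\tilde\tau_{n,m}\,j_{n,m}(g,h)\,\tilde\tau_{n,m}^{-1}=c^{\,nm|g|+nm|h|+|g||h|}\,j_{m,n}(h,g).$$
   Context: $\tilde{\mathfrak S}_n$ (the spin-symmetric group) is the group generated by $\tilde s_1,\dots,\tilde s_{n-1},c$ subject to: $c$ is central and $c^2=1$; $\tilde s_i^2=1$; $\tilde s_i\tilde s_{i+1}\tilde s_i=\tilde s_{i+1}\tilde s_i\tilde s_{i+1}$ for $1\le i\le n-2$; $\tilde s_i\tilde s_j=c\,\tilde s_j\tilde s_i$ for $|i-j|\ge2$. The parity $|\cdot|:\tilde{\mathfrak S}_n\to\mathbb{Z}/2$ is the homomorphism with $|\tilde s_i|=1$, $|c|=0$. In $\tilde{\mathfrak S}_{n+m}$ put $\tilde\sigma_{n,i}=\tilde s_i\tilde s_{i+1}\cdots\tilde s_{i+n-1}$ and $\tilde\tau_{n,m}=\tilde\sigma_{n,m}\tilde\sigma_{n,m-1}\cdots\tilde\sigma_{n,1}$. For $g\in\tilde{\mathfrak S}_n$, $h\in\tilde{\mathfrak S}_m$ put $j_{n,m}(g,h)=\iota_1(g)\iota_2(h)\in\tilde{\mathfrak S}_{n+m}$, where $\iota_1:\tilde{\mathfrak S}_n\to\tilde{\mathfrak S}_{n+m}$ and $\iota_2:\tilde{\mathfrak S}_m\to\tilde{\mathfrak S}_{n+m}$ are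 the homomorphisms with $\iota_1(\tilde s_i)=\tilde s_i$, $\iota_2(\tilde s_i)=\tilde s_{n+i}$, and $c\mapsto c$. *)

(* Defs.v *)
From HB Require Import structures.
From mathcomp Require Import all_boot all_fingroup all_algebra.
From mathcomp Require Import boolp.

Set Implicit Arguments.
Unset Strict Implicit.
Unset Printing Implicit Defensive.

Local Open Scope group_scope.
Local Open Scope quotient_scope.

(* Groups given by generators and relations: formal group expressions in the
   generators, modulo the least congruence containing the group axioms and the
   prescribed relations. *)

Inductive gexp (X : Type) : Type :=
| GGen of X
| GOne
| GMul of gexp X & gexp X
| GInv of gexp X.

Arguments GOne {X}.

HB.instance Definition _ (X : Type) := gen_eqMixin (gexp X).
HB.instance Definition _ (X : Type) := gen_choiceMixin (gexp X).

Inductive geq (X : Type) (R : gexp X -> gexp X -> Prop) :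
  gexp X -> gexp X -> Prop :=
| geq_rel u v : R u v -> geq R u v
| geq_refl u : geq R u u
| geq_sym u v : geq R u v -> geq R v u
| geq_trans u v w : geq R u v -> geq R v w -> geq R u w
| geq_mul u u' v v' :
    geq R u u' -> geq R v v' -> geq R (GMul u v) (GMul u' v')
| geq_inv u u' : geq R u u' -> geq R (GInv u) (GInv u')
| geq_mulA u v w : geq R (GMul u (GMul v w)) (GMul (GMul u v) w)
| geq_mul1l u : geq R (GMul GOne u) u
| geq_mul1r u : geq R (GMul u GOne) u
| geq_mulVl u : geq R (GMul (GInv u) u) GOne
| geq_mulVr u : geq R (GMul u (GInv u)) GOne.

Section Presentation.
Variables (X : Type) (R : gexp X -> gexp X -> Prop).

Definition geqb (u v : gexp X) : bool := `[< geq R u v >].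

Lemma geqb_equiv : equiv_class_of geqb.
Proof.
split=> [u|u v|v u w].
- by apply/asboolP; apply: geq_refl.
- by apply/asboolP/asboolP; apply: geq_sym.
- by move=> /asboolP uv /asboolP vw; apply/asboolP; apply: geq_trans vw.
Qed.

Canonical geq_equiv_rel := EquivRelPack geqb_equiv.

Definition pres : Type := {eq_quot geq_equiv_rel}.

HB.instance Definition _ := Choice.copy pres {eq_quot geq_equiv_rel}.

Definition pres_pi (u : gexp X) : pres := \pi_({eq_quot geq_equiv_rel}) u.
Definition pres_repr (x : pres) : gexp X :=
  generic_quotient.repr (x : {eq_quot geq_equiv_rel}).

Lemma pres_reprK x : pres_pi (pres_repr x) = x.
Proof. exact: reprK. Qed.

Lemma pres_piP u v : pres_pi u = pres_pi v <-> geq R u v.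
Proof.
split=> [/eqmodP/asboolP//|uv]; apply/eqmodP; exact/asboolP.
Qed.

Lemma pres_repr_pi u : geq R (pres_repr (pres_pi u)) u.
Proof. by apply/pres_piP; rewrite pres_reprK. Qed.

Definition pres_one : pres := pres_pi GOne.
Definition pres_mul (x y : pres) : pres :=
  pres_pi (GMul (pres_repr x) (pres_repr y)).
Definition pres_inv (x : pres) : pres := pres_pi (GInv (pres_repr x)).

Fact pres_pi_mul u v : pres_pi (GMul u v) = pres_mul (pres_pi u) (pres_pi v).
Proof.
by apply/pres_piP; apply: geq_mul; apply: geq_sym; apply: pres_repr_pi.
Qed.

Fact pres_pi_inv u : pres_pi (GInv u) = pres_inv (pres_pi u).
Proof. by apply/pres_piP; apply/geq_inv/geq_sym/pres_repr_pi. Qed.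

Fact pres_mulA : associative pres_mul.
Proof.
move=> x y z; rewrite -[x]pres_reprK -[y]pres_reprK -[z]pres_reprK.
by rewrite -!pres_pi_mul; apply/pres_piP/geq_mulA.
Qed.

Fact pres_mul1l : left_id pres_one pres_mul.
Proof.
move=> x; rewrite -[x]pres_reprK -!pres_pi_mul; exact/pres_piP/geq_mul1l.
Qed.

Fact pres_mul1r : right_id pres_one pres_mul.
Proof.
move=> x; rewrite -[x]pres_reprK -!pres_pi_mul; exact/pres_piP/geq_mul1r.
Qed.

Fact pres_mulVl : left_inverse pres_one pres_inv pres_mul.
Proof.
move=> x; rewrite -[x]pres_reprK -pres_pi_inv -pres_pi_mul.
exact/pres_piP/geq_mulVl.
Qed.

Fact pres_mulVr : right_inverse pres_one pres_inv pres_mul.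
Proof.
move=> x; rewrite -[x]pres_reprK -pres_pi_inv -pres_pi_mul.
exact/pres_piP/geq_mulVr.
Qed.

HB.instance Definition _ := isGroup.Build pres
  pres_mulA pres_mul1l pres_mul1r pres_mulVl pres_mulVr.

Lemma pres_piM u v : pres_pi (GMul u v) = pres_pi u * pres_pi v.
Proof. exact: pres_pi_mul. Qed.

Lemma pres_piV u : pres_pi (GInv u) = (pres_pi u)^-1.
Proof. exact: pres_pi_inv. Qed.

Definition pgen (x : X) : pres := pres_pi (GGen x).

End Presentation.

Fixpoint geval (X : Type) (G : groupType) (f : X -> G) (u : gexp X) : G :=
  match u with
  | GGen x => f x
  | GOne => 1
  | GMul u v => geval f u * geval f v
  | GInv u => (geval f u)^-1
  end.

Lemma geval_pgen (X : Type) (R : gexp X -> gexp X -> Prop) (u : gexp X) :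
  geval (pgen R) u = pres_pi R u.
Proof.
elim: u => [//|//|u IHu v IHv|u IHu] /=.
- by rewrite IHu IHv pres_piM.
- by rewrite IHu pres_piV.
Qed.

Lemma pgen_rel (X : Type) (R : gexp X -> gexp X -> Prop) (u v : gexp X) :
  R u v -> geval (pgen R) u = geval (pgen R) v.
Proof. by move=> Ruv; rewrite !geval_pgen; apply/pres_piP/geq_rel. Qed.

Section Lift.
Variables (X : Type) (R : gexp X -> gexp X -> Prop) (G : groupType).
Variables (f : X -> G) (fR : forall u v, R u v -> geval f u = geval f v).

Lemma geval_geq u v : geq R u v -> geval f u = geval f v.
Proof using fR.
elim=> {u v} //=.
- by move=> u v w _ -> _ ->.
- by move=> u u' v v' _ -> _ ->.
- by move=> u u' _ ->.
- by move=> *; rewrite mulgA.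
- by move=> *; rewrite mul1g.
- by move=> *; rewrite mulg1.
- by move=> *; rewrite mulVg.
- by move=> *; rewrite mulgV.
Qed.

(* The proof argument is unused in the body: it only serves to attach the
   canonical morphism structure to [plift fR]. *)
Definition plift of (forall u v, R u v -> geval f u = geval f v) :=
  fun x : pres R => geval f (pres_repr x).

Lemma plift_pi u : plift fR (pres_pi R u) = geval f u.
Proof. exact/geval_geq/pres_repr_pi. Qed.

Lemma pliftE x : plift fR (pgen R x) = f x.
Proof. exact: plift_pi. Qed.

Fact plift_monoid_morphism : monoid_morphism (plift fR).
Proof. by split=> [|x y]; apply: plift_pi. Qed.

HB.instance Definition _ :=
  isUMagmaMorphism.Build (pres R) G (plift fR) plift_monoid_morphism.

Lemma plift_uniq (F : UMagmaMorphism.type (pres R) G) :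
  (forall x, F (pgen R x) = f x) -> F =1 plift fR.
Proof.
move=> Ff x; rewrite -[x]pres_reprK plift_pi.
elim: (pres_repr x) => {x} [x||u IHu v IHv|u IHu] /=.
- exact: Ff.
- exact: gmulf1.
- by rewrite pres_piM gmulfM IHu IHv.
- by rewrite pres_piV gmulfV IHu.
Qed.

End Lift.

(* The spin-symmetric group; the generators s_i keep their indices
   i = 1, .., n - 1, so there are none if n <= 1. *)

Definition spin_idx (n : nat) := {i : nat | 0 < i < n}%N.

Inductive spin_gen (n : nat) : Type :=
| SpinS of spin_idx n
| SpinC.

Arguments SpinC {n}.

Section SpinRel.
Variable n : nat.
Local Notation S i := (GGen (@SpinS n i)).
Local Notation C := (GGen (@SpinC n)).
Local Notation "u ** v" := (GMul u v) (at level 40, left associativity).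

Inductive spin_rel : gexp (spin_gen n) -> gexp (spin_gen n) -> Prop :=
| spin_rel_central i : spin_rel (C ** S i) (S i ** C)
| spin_rel_cc : spin_rel (C ** C) GOne
| spin_rel_ss i : spin_rel (S i ** S i) GOne
| spin_rel_braid i j of val j = (val i).+1 :
    spin_rel (S i ** S j ** S i) (S j ** S i ** S j)
| spin_rel_far i j of (val i + 2 <= val j)%N || (val j + 2 <= val i)%N :
    spin_rel (S i ** S j) (C ** S j ** S i).

End SpinRel.

Definition spin (n : nat) : groupType := pres (@spin_rel n).

Definition spc {n : nat} : spin n := pgen (@spin_rel n) SpinC.

(* Set to 1 for i outside the range 1 <= i <= n - 1. *)
Definition sps {n : nat} (i : nat) : spin n :=
  if insub i is Some k then pgen (@spin_rel n) (SpinS k) else 1.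

Section SpinTheory.
Variable n : nat.
Implicit Types i j : nat.

Lemma spsE i (lt_i : (0 < i < n)%N) :
  sps i = pgen (@spin_rel n) (SpinS (exist _ i lt_i)).
Proof. by rewrite /sps insubT. Qed.

Lemma sps_out i : ~~ (0 < i < n)%N -> sps i = 1 :> spin n.
Proof. by move=> n_i; rewrite /sps insubN. Qed.

Lemma spc_spsC i : spc * sps i = sps i * spc :> spin n.
Proof.
have [lt_i|n_i] := boolP (0 < i < n)%N; last by rewrite sps_out ?mulg1 ?mul1g.
by rewrite spsE; apply: (pgen_rel (spin_rel_central _)).
Qed.

Lemma spc2 : spc * spc = 1 :> spin n.
Proof. exact: (pgen_rel (spin_rel_cc n)). Qed.

Lemma sps2 i : sps i * sps i = 1 :> spin n.
Proof.
have [lt_i|n_i] := boolP (0 < i < n)%N; last by rewrite sps_out ?mulg1.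
by rewrite spsE; apply: (pgen_rel (spin_rel_ss _)).
Qed.

Lemma sps_braid i : (0 < i)%N -> (i.+1 < n)%N ->
  sps i * sps i.+1 * sps i = sps i.+1 * sps i * sps i.+1 :> spin n.
Proof.
move=> i_gt0 lt_i1.
have lt_i : (0 < i < n)%N by rewrite i_gt0 ltnW.
by rewrite !spsE; apply: (pgen_rel (spin_rel_braid _)).
Qed.

Lemma sps_far i j : (0 < i < n)%N -> (0 < j < n)%N ->
  (i + 2 <= j)%N || (j + 2 <= i)%N ->
  sps i * sps j = spc * sps j * sps i :> spin n.
Proof.
move=> lt_i lt_j far.
by rewrite !spsE; apply: (pgen_rel (spin_rel_far _)).
Qed.

Definition spin_fun (G : Type) (s : nat -> G) (z : G) (x : spin_gen n) : G :=
  if x is SpinS i then s (val i) else z.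

End SpinTheory.

(* The parity takes values in the additive group 'Z_2, whose groupType
   structure is addition: its unit is 0%R. *)
Fact parity_rel n u v : spin_rel u v ->
  geval (spin_fun (n := n) (fun=> 1%R : 'Z_2) (0%R : 'Z_2)) u =
  geval (spin_fun (fun=> 1%R : 'Z_2) (0%R : 'Z_2)) v.
Proof. by case=> *; apply/val_inj. Qed.

Definition parity {n : nat} : spin n -> 'Z_2 := plift (@parity_rel n).

Fact iota1_rel n m u v : spin_rel u v ->
  geval (spin_fun (n := n) (sps : nat -> spin (n + m)) spc) u =
  geval (spin_fun sps spc) v.
Proof.
have widen i : (0 < i < n -> 0 < i < n + m)%N.
  by case/andP=> -> /=; apply: ltn_addr.
case=> [i||i|i j ij|i j ij] /=.
- exact: spc_spsC.
- exact: spc2.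
- exact: sps2.
- rewrite ij sps_braid -?ij //; first by case/andP: (valP i).
  by case/andP: (widen _ (valP j)).
- exact: sps_far (widen _ (valP i)) (widen _ (valP j)) ij.
Qed.

Definition iota1 (n m : nat) : spin n -> spin (n + m) := plift (@iota1_rel n m).

Fact iota2_rel n m u v : spin_rel u v ->
  geval (spin_fun (n := m) (fun i => sps (n + i) : spin (n + m)) spc) u =
  geval (spin_fun (fun i => sps (n + i)) spc) v.
Proof.
have shift i : (0 < i < m -> 0 < n + i < n + m)%N.
  by case/andP=> i_gt0 lt_i; rewrite ltn_add2l lt_i ltn_addl.
case=> [i||i|i j ij|i j ij] /=.
- exact: spc_spsC.
- exact: spc2.
- exact: sps2.
- rewrite ij addnS sps_braid -?addnS -?ij //.
    by case/andP: (shift _ (valP i)).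
  by rewrite leq_add2l; case/andP: (valP j).
- apply: sps_far (shift _ (valP i)) (shift _ (valP j)) _.
  by rewrite -!addnA !leq_add2l.
Qed.

Definition iota2 (n m : nat) : spin m -> spin (n + m) := plift (@iota2_rel n m).

HB.instance Definition _ n := Multiplicative.on (@parity n).
HB.instance Definition _ n m := Multiplicative.on (@iota1 n m).
HB.instance Definition _ n m := Multiplicative.on (@iota2 n m).

Section Characterizations.
Variables n m : nat.

Lemma parity_s i : (0 < i < n)%N -> parity (sps i : spin n) = 1%R.
Proof. by move=> lt_i; rewrite spsE; apply: pliftE. Qed.

Lemma parity_c : parity (spc : spin n) = 0%R.
Proof. exact: pliftE. Qed.

Lemma iota1_s i : (0 < i < n)%N -> iota1 m (sps i : spin n) = sps i.
Proof. by move=> lt_i; rewrite spsE; apply: pliftE. Qed.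

Lemma iota1_c : iota1 m (spc : spin n) = spc.
Proof. exact: pliftE. Qed.

Lemma iota2_s i : (0 < i < m)%N -> iota2 n (sps i : spin m) = sps (n + i).
Proof. by move=> lt_i; rewrite [in LHS]spsE; apply: pliftE. Qed.

Lemma iota2_c : iota2 n (spc : spin m) = spc.
Proof. exact: pliftE. Qed.

Definition spj (g : spin n) (h : spin m) : spin (n + m) :=
  iota1 m g * iota2 n h.

Definition spsigma (i : nat) : spin (n + m) := \prod_(k < n) sps (i + k).

Definition sptau : spin (n + m) := \prod_(k < m) spsigma (m - k).

End Characterizations.

(* The identification of spin groups of propositionally equal degrees. *)
Definition spin_cast (n m : nat) (eq_nm : n = m) (x : spin n) : spin m :=
  ecast k (spin k) eq_nm x.

Lemma spin_cast_s n m (eq_nm : n = m) i :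
  spin_cast eq_nm (sps i : spin n) = sps i.
Proof. by case: m / eq_nm. Qed.

Lemma spin_cast_c n m (eq_nm : n = m) : spin_cast eq_nm (spc : spin n) = spc.
Proof. by case: m / eq_nm. Qed.

(* Main.v *)
(** Conjugation by [sptau n m] moves [s_k] past each of the [m] factors
    [spsigma i], each time shifting the index by one and producing the sign
    [c ^ n]; it moves [s_(n + j)] past all factors at the cost of [c ^ n] each,
    except that the adjacent pair [spsigma j.+1 * spsigma j] turns [s_(n + j)]
    into [s_j] without sign.  Hence both embeddings are intertwined on generators
    with the sign [c ^ (n * m)], and the last sign [c ^ (|g| |h|)] comes from
    exchanging two blocks of mutually distant generators. *)

Require Import Defs.
From mathcomp Require Import all_boot all_fingroup all_algebra.
From mathcomp Require Import zify.
Local Open Scope group_scope.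

Set Implicit Arguments.
Unset Strict Implicit.

Section SpinWords.
Context {N : nat}.
Implicit Types (g x y t u : spin N) (a b : nat).

(** All generators are involutions, so inverses bring no new letters and every element is a word in
    [spc] and the [sps i]. *)
Lemma spin_ind (P : spin N -> Prop) :
    P 1 -> (forall g, P g -> P (spc * g)) ->
    (forall i g, (0 < i < N)%N -> P g -> P (sps i * g)) ->
  forall g, P g.
Proof.
move=> P1 Pc Ps g.
have cV : spc^-1 = spc :> spin N by apply/(mulgI spc); rewrite mulgV spc2.
have sV i : (sps i)^-1 = sps i :> spin N.
  by apply/(mulgI (sps i)); rewrite mulgV sps2.
(* Asking for stability under both [g] and [g^-1] lets the induction on expressions pass through
   inversion, which only swaps the two halves. *)
suff [Pg _] : (forall x, P x -> P (g * x)) /\ (forall x, P x -> P (g^-1 * x)).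
  by rewrite -[g]mulg1; apply: Pg.
rewrite -[g]pres_reprK; elim: (pres_repr g) => [x||u IHu v IHv|u IHu].
- suff Px y : P y -> P (pgen (@spin_rel N) x * y).
    split=> // y Py; suff -> : (pres_pi (@spin_rel N) (GGen x))^-1 =
      pgen (@spin_rel N) x by apply: Px.
    by case: x {Px} => [[i lt_i]|]; [have := sV i; rewrite spsE | exact: cV].
  case: x => [[i lt_i]|]; last exact: Pc.
  by rewrite -spsE; apply: Ps.
- by split=> x; rewrite ?invg1 mul1g.
- rewrite pres_piM; case: IHu IHv => Pu PuV [Pv PvV].
  by split=> x Px; rewrite ?invgM -mulgA; [apply/Pu/Pv | apply/PvV/PuV].
- by rewrite pres_piV invgK; case: IHu.
Qed.

Lemma spcC g : spc * g = g * spc.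
Proof.
elim/spin_ind: g => [|g IHg|i g _ IHg]; first by rewrite mulg1 mul1g.
  by rewrite -mulgA -IHg.
by rewrite mulgA spc_spsC -!mulgA IHg.
Qed.

Lemma spcXC a g : spc ^+ a * g = g * spc ^+ a.
Proof.
elim: a => [|a IHa]; first by rewrite !expg0 mulg1 mul1g.
by rewrite !expgS -mulgA IHa !mulgA spcC.
Qed.

Lemma spcX_odd a b : odd a = odd b -> spc ^+ a = spc ^+ b :> spin N.
Proof.
have red c : spc ^+ c = spc ^+ odd c :> spin N.
  by rewrite -[in LHS](odd_double_half c) expgD -mul2n expgM expgS expg1 spc2
             expg1n mulg1.
by move=> eq_ab; rewrite red eq_ab -red.
Qed.

(** The conjugation [t * x * t^-1 = spc ^+ a * y] freed of inverses. Only the parity of [a] matters,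
    and exponents add under composition and products. *)
Definition intertwines t a x y := t * x = spc ^+ a * y * t.

Lemma intertwines_odd t a b x y :
  odd a = odd b -> intertwines t a x y -> intertwines t b x y.
Proof. by rewrite /intertwines => /spcX_odd <-. Qed.

Lemma intertwinesMl t u a b x y z :
  intertwines t a x y -> intertwines u b y z -> intertwines (u * t) (a + b) x z.
Proof.
rewrite /intertwines => tx uy.
by rewrite -mulgA tx !mulgA -spcXC -(mulgA _ u y) uy expgD !mulgA.
Qed.

Lemma intertwinesMr t a b x x' y y' :
  intertwines t a x y -> intertwines t b x' y' ->
  intertwines t (a + b) (x * x') (y * y').
Proof.
rewrite /intertwines => tx tx'.
by rewrite mulgA tx -!mulgA tx' expgD !mulgA -(mulgA _ y) -spcXC !mulgA.
Qed.

Lemma intertwines1 x : intertwines 1 0 x x.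
Proof. by rewrite /intertwines expg0 !mul1g mulg1. Qed.

Lemma intertwines1r t : intertwines t 0 1 1.
Proof. by rewrite /intertwines expg0 !mul1g mulg1. Qed.

Lemma intertwines_spc t : intertwines t 0 spc spc.
Proof. by rewrite /intertwines expg0 mul1g spcC. Qed.

(** This is commutation up to the sign [spc ^+ a], which is central and its own inverse. *)
Lemma intertwines_sym t a x : intertwines t a x x -> intertwines x a t t.
Proof.
rewrite /intertwines => tx.
rewrite -[RHS]mulgA tx !mulgA -expgD (@spcX_odd _ 0) ?expg0 ?mul1g //.
by rewrite addnn odd_double.
Qed.

Lemma intertwines_far i j : (0 < i < N)%N -> (0 < j < N)%N ->
  (i + 2 <= j)%N || (j + 2 <= i)%N -> intertwines (sps i) 1 (sps j) (sps j).
Proof. exact: sps_far. Qed.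

(** [spsigma] in a degree [N] independent of [n], so that inductions on the length stay in one
    group. *)
Definition sigma n i : spin N := \prod_(k < n) sps (i + k).

Lemma sigma0 i : sigma 0 i = 1. Proof. exact: big_ord0. Qed.

Lemma sigmaS n i : sigma n.+1 i = sigma n i * sps (i + n).
Proof. exact: big_ord_recr. Qed.

Lemma sigma_far n i j : (0 < i)%N -> (i + n <= N)%N -> (0 < j < N)%N ->
  (j + 2 <= i)%N || (i + n < j)%N ->
  intertwines (sigma n i) n (sps j) (sps j).
Proof.
move=> i_gt0; elim: n => [|n IHn] le_N lt_j far.
  by rewrite sigma0; apply: intertwines1.
rewrite sigmaS -add1n; apply: (intertwinesMl (y := sps j)).
  by apply: intertwines_far; lia.
by apply: IHn; lia.
Qed.

(** The letters after [sps k.+1] are far from [sps k], those before [sps k] are far from [sps k.+1]: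
    one sign each. The two middle letters act by the braid relation, without sign. *)
Lemma sigma_shift n i k : (0 < i <= k)%N -> (k.+1 < i + n)%N -> (i + n <= N)%N ->
  intertwines (sigma n i) n (sps k) (sps k.+1).
Proof.
move=> /andP[i_gt0 le_ik]; elim: n => [|n IHn] lt_k le_N; first by lia.
have [lt_kn|le_kn] := ltnP k.+1 (i + n).
  rewrite sigmaS -add1n; apply: (intertwinesMl (y := sps k)).
    by apply: intertwines_far; lia.
  by apply: IHn; lia.
case: n {IHn} => [|p] in lt_k le_N le_kn *; first by lia.
have -> : k = (i + p)%N by lia.
(* The length is [p.+2]; the two braiding letters are free, leaving [p] signs, the same modulo 2. *)
apply: (@intertwines_odd _ (0 + p)); first by rewrite add0n /= negbK.
rewrite !sigmaS -mulgA; apply: (intertwinesMl (y := sps (i + p).+1)).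
  by rewrite /intertwines expg0 mul1g addnS mulgA sps_braid //; lia.
by apply: sigma_far; lia.
Qed.

Lemma sigma_pair n j : (0 < j)%N -> (j + n < N)%N ->
  intertwines (sigma n j.+1 * sigma n j) 0 (sps (j + n)) (sps j).
Proof.
move=> j_gt0; elim: n => [|n IHn] lt_N.
  by rewrite !sigma0 mulg1 addn0; apply: intertwines1.
(* Bringing the two last letters together costs a central factor, which conjugation ignores; the
   braid relation then lowers the index by one. *)
have swap : sigma n.+1 j.+1 * sigma n.+1 j = spc ^+ n *
    (sigma n j.+1 * sigma n j * (sps (j + n).+1 * sps (j + n))).
  have /intertwines_sym far : intertwines (sigma n j) n (sps (j + n).+1)
    (sps (j + n).+1) by apply: sigma_far; lia.
  rewrite !sigmaS addSn -mulgA (mulgA (sps _)) far !mulgA.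
  by rewrite spcXC.
rewrite swap -[0%N]/(0 + 0 + 0)%N.
apply: (intertwinesMl (y := sps j)); last by rewrite /intertwines mul1g spcXC.
apply: (intertwinesMl (y := sps (j + n))); last by apply: IHn; lia.
by rewrite /intertwines expg0 mul1g addnS mulgA sps_braid //; lia.
Qed.

Definition tau n p : spin N := \prod_(k < p) sigma n (p - k).

Lemma tau0 n : tau n 0 = 1. Proof. exact: big_ord0. Qed.

Lemma tauS n p : tau n p.+1 = sigma n p.+1 * tau n p.
Proof. by rewrite /tau big_ord_recl subn0. Qed.

Lemma tau_shift n p k : (0 < k < n)%N -> (n + p <= N)%N ->
  intertwines (tau n p) (p * n) (sps k) (sps (p + k)).
Proof.
move=> lt_k; elim: p => [|p IHp] le_N; first by rewrite tau0; apply: intertwines1.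
rewrite tauS mulSn addnC; apply: intertwinesMl (IHp _) _; first by lia.
by rewrite addSn; apply: sigma_shift; lia.
Qed.

Lemma tau_far n p j : (n + p < j < N)%N ->
  intertwines (tau n p) (p * n) (sps j) (sps j).
Proof.
elim: p => [|p IHp] lt_j; first by rewrite tau0; apply: intertwines1.
rewrite tauS mulSn addnC; apply: intertwinesMl (IHp _) _; first by lia.
by apply: sigma_far; lia.
Qed.

Lemma tau_unshift n p j : (0 < j < p)%N -> (n + p <= N)%N ->
  intertwines (tau n p) (p * n) (sps (n + j)) (sps j).
Proof.
elim: p => [|p IHp] lt_j le_N; first by lia.
have [lt_jp|le_pj] := ltnP j p.
  rewrite tauS mulSn addnC; apply: (intertwinesMl (y := sps j)).
    by apply: IHp; lia.
  by apply: sigma_far; lia.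
case: p {IHp} => [|q] in lt_j le_N le_pj *; first by lia.
have -> : j = q.+1 by lia.
(* The top two factors form the sign-free pair, and the [q] others give [n] signs each; [q * n] and
   [q.+2 * n] have the same parity. *)
apply: (@intertwines_odd _ (q * n + 0)).
  by rewrite addn0 !mulSn !oddD addbA addbb.
rewrite !tauS mulgA; apply: (intertwinesMl (y := sps (n + q.+1))).
  by apply: tau_far; lia.
by rewrite addnC; apply: sigma_pair; lia.
Qed.

End SpinWords.

Lemma parity1 n : parity (1 : spin n) = 0%R.
Proof. exact: plift_pi. Qed.

Lemma parityM n (g h : spin n) : parity (g * h) = (parity g + parity h)%R.
Proof. exact: gmulfM. Qed.

(** Each letter [sps i] contributes [a] signs and [spc] none, so the total depends only on the
    parity of the word. *)
Lemma intertwines_morph N n (f1 f2 : spin n -> spin N) (t : spin N) a :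
    {morph f1 : x y / x * y} -> {morph f2 : x y / x * y} ->
    f1 spc = spc -> f2 spc = spc ->
    (forall i, (0 < i < n)%N -> intertwines t a (f1 (sps i)) (f2 (sps i))) ->
  forall g : spin n, intertwines t (a * parity g) (f1 g) (f2 g).
Proof.
move=> f1M f2M f1c f2c ts.
have morph1 (f : spin n -> spin N) : {morph f : x y / x * y} -> f 1 = 1.
  by move=> fM; apply/(mulgI (f 1)); rewrite -fM !mulg1.
elim/(@spin_ind n) => [|g IHg|i g lt_i IHg].
- by rewrite parity1 muln0 !morph1 //; apply: intertwines1r.
- rewrite parityM parity_c GRing.add0r f1M f2M f1c f2c -[(a * _)%N]add0n.
  exact: intertwinesMr (intertwines_spc t) IHg.
(* Parities add in ['Z_2] but exponents in [nat], so they agree only modulo 2. *)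
- rewrite f1M f2M; apply: intertwines_odd (intertwinesMr (ts i lt_i) IHg).
  rewrite parityM parity_s // oddD !oddM.
  by case: (parity g) => [[|[|]]] //= _; rewrite ?andbT ?andbF ?addbb ?addbF.
Qed.

Lemma spin_castM n m (eq_nm : n = m) :
  {morph spin_cast eq_nm : x y / x * y}.
Proof. by case: m / eq_nm. Qed.

Unset Implicit Arguments.

Theorem proposition5p5 (n m : nat) (g : spin n) (h : spin m) :
  sptau n m * spj g h * (sptau n m)^-1 =
  spc ^+ (n * m * parity g + n * m * parity h + parity g * parity h)%N *
  spin_cast (addnC m n) (spj h g).
Proof.
pose cast := spin_cast (addnC m n).
pose k1 x := cast (iota1 n x); pose k2 x := cast (iota2 m x).
have i1M : {morph @iota1 n m : x y / x * y} by move=> x y; apply: gmulfM.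
have i2M : {morph @iota2 n m : x y / x * y} by move=> x y; apply: gmulfM.
have k1M : {morph k1 : x y / x * y} by move=> x y; rewrite /k1 /cast gmulfM spin_castM.
have k2M : {morph k2 : x y / x * y} by move=> x y; rewrite /k2 /cast gmulfM spin_castM.
have k1c : k1 spc = spc by rewrite /k1 iota1_c; apply: spin_cast_c.
have k2c : k2 spc = spc by rewrite /k2 iota2_c; apply: spin_cast_c.
have k1s i : (0 < i < m)%N -> k1 (sps i) = sps i.
  by move=> lt_i; rewrite /k1 iota1_s //; apply: spin_cast_s.
have k2s i : (0 < i < n)%N -> k2 (sps i) = sps (m + i).
  by move=> lt_i; rewrite /k2 iota2_s //; apply: spin_cast_s.
have tau_g : intertwines (sptau n m) (m * n * parity g) (iota1 m g) (k2 g).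
  apply: intertwines_morph => // [|i lt_i]; first exact: iota1_c.
  by rewrite iota1_s // k2s //; apply: tau_shift.
have tau_h : intertwines (sptau n m) (m * n * parity h) (iota2 n h) (k1 h).
  apply: intertwines_morph => // [|i lt_i]; first exact: iota2_c.
  by rewrite iota2_s // k1s //; apply: tau_unshift.
have k2k1 : intertwines (k2 g) (parity g * parity h) (k1 h) (k1 h).
  (* Reduction to generators first in [h], then, with the roles exchanged, in [g]; indices below [m]
     are far from those above [m]. *)
  apply: intertwines_morph => // i lt_i; apply: intertwines_sym.
  rewrite -[X in intertwines _ X]mul1n; apply: intertwines_morph => // j lt_j.
  by rewrite k1s // k2s //; apply: intertwines_far; lia.
(* Conjugation leaves the blocks in the order [k2 g * k1 h]; [k2k1] reverses them and supplies the
   last sign. *)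
rewrite /spj (intertwinesMr tau_g tau_h) mulgK k2k1 spin_castM !mulgA -expgD.
by rewrite [in LHS](mulnC m n).
Qed.
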